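(* Let $X_1,X_2,\dots$ be independent identically distributed real random variables, $S(n)=X_1+\dots+X_n$, and $\tau_0:=\inf\{n\ge1:\ S(n)\le0\}$. Assume that $\mathbf P(S(n)>0)\to\varrho\in(0,1)$ as $n\to\infty$. Then there exists a slowly varying function $\ell(n)$ such that $$\mathbf P(\tau_0>n)=n^{\varrho-1}\ell(n).$$
   Context: Slowly varying means slowly varying at infinity. *)

(* Defs.v *)
From mathcomp Require Export all_boot all_order all_algebra.
From mathcomp Require Export all_classical all_reals all_analysis.
Export Order.TTheory GRing.Theory Num.Theory numFieldNormedType.Exports.

Set Implicit Arguments.
Unset Strict Implicit.
Unset Printing Implicit Defensive.

Local Open Scope classical_set_scope.
Local Open Scope ring_scope.

Definition mutually_independent d (T : measurableType d) (R : realType)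
    (P : probability T R) (X : nat -> {RV P >-> R}) : Prop :=
  forall (J : seq nat) (B : nat -> set R), uniq J ->
    (forall i, measurable (B i)) ->
    P (\bigcap_(i in [set` J]) (X i @^-1` B i)) =
      (\prod_(i <- J) P (X i @^-1` B i))%E.

Definition identically_distributed d (T : measurableType d) (R : realType)
    (P : probability T R) (X : nat -> {RV P >-> R}) : Prop :=
  forall (i j : nat) (B : set R), measurable B ->
    distribution P (X i) B = distribution P (X j) B.

(* Sequences are indexed from 0: [X k] stands for the step X_{k+1}, so that
   [walk X n] is X_1 + ... + X_n and [walk X 0 w = 0]. *)
Definition walk (T : Type) (R : realType) (X : nat -> T -> R) (n : nat)
    (w : T) : R :=
  \sum_(k < n) X k w.

(* The infimum of the empty set is [+oo]: the walk may never enter ]-oo, 0]. *)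
Definition tau0 (T : Type) (R : realType) (X : nat -> T -> R) (w : T) : \bar R :=
  ereal_inf [set n%:R%:E | n in [set n : nat | (1 <= n)%N /\ walk X n w <= 0]].

Definition slowly_varying (R : realType) (l : R -> R) : Prop :=
  [/\ measurable_fun (`]0, +oo[ : set R) l,
      forall x : R, 0 < x -> 0 < l x &
      forall a : R, 0 < a -> l (a * x) / l x @[x --> +oo] --> (1 : R)].

(* Main.v *)
Require Import Defs.
From mathcomp Require Import measurable_realfun lra ring zify.

(**
Write S n for the walk, p n = P(S 1 > 0, ..., S n > 0), which is P(tau0 > n),
a n = P(S n > 0), and U n = p 0 + ... + p (n - 1).  Everything rests on the
recurrence n p n = sum_(k < n) a (n - k) p k ([spitzer_recurrence]), which is
the logarithmic derivative of the Sparre Andersen formula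
  sum_n p n s^n = exp (sum_(k >= 1) a k s^k / k).

From the recurrence to regular variation.  As p is nonincreasing, each single
p k is at most U n / (k + 1), so that the terms of the recurrence with k close
to n are negligible with respect to U n; in all the other terms a (n - k) is
close to rho.  Hence n p n / U n tends to rho ([cvg_ratio_partial_sum]): the
monotonicity of p plays the part of a Tauberian theorem.  Consequently
U (n + 1) / U n = 1 + (rho + o(1)) / n, so that W n = ln (U n) - rho ln n has
increments o(1 / n), and such a sequence moves by o(1) between x and b x
([cvg_small_increments]).  Thus n^(1 - rho) p n = (n p n / U n) exp (W n) is
slowly varying ([recurrence_regularly_varying]).

Proof of the recurrence.  A path that is positive at the times 1, ..., n is
split at the last time k at which it attains its minimum over these times.
Before k it is a block (it ends at its positive minimum), after k it stays
above its value at k for n - k steps.  With f k the probability of a block of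
length k, independence of the two parts gives, for n > 0,
  p n = sum_(1 <= k <= n) f k p (n - k)              ([renewal_stay]).
Next wrap the n steps around a circle.  If S n > 0, the times whose later
values are all larger form a nonempty periodic set of cuts, and the gaps
between consecutive cuts add up to n over one period; if S n <= 0 no rotation
of the steps gives a positive path.  Since all the rotations have the same
law, taking expectations gives
  a n = sum_(1 <= k <= n) k f k p (n - k)            ([cyclic_block_length]).
Let D be the derivation u |-> (n u n)_n of the convolution algebra of
sequences.  The identities read p = 1 + f * p and a = D f * p, therefore
D p = D f * p + f * D p, that is (1 - f) * D p = a, and D p = a * p because p
is the inverse of 1 - f ([renewal_derivative]).
*)

Local Open Scope classical_set_scope.
Local Open Scope ring_scope.

Set Implicit Arguments.
Unset Strict Implicit.
Unset Printing Implicit Defensive.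

(** * Decomposition of a path at its future minima *)

Section paths.
Context {R : realDomainType}.
Implicit Types (x y : nat -> R).

Definition psum x n : R := \sum_(j < n) x j.
Definition shift k x : nat -> R := fun j => x (k + j)%N.
Definition stay n x : bool := [forall j : 'I_n, 0 < psum x j.+1].
Definition block k x : bool :=
  (0 < psum x k) && [forall j : 'I_k, (0 < j)%N ==> (psum x k <= psum x j)].

(** The first future minimum after time 0 of a path that stays positive up to
time n is k: the minimum over the times 1, ..., n is last attained at k. *)
Definition first_cut n k x : bool := block k x && stay (n - k) (shift k x).

Lemma stayP n x : reflect (forall j, (0 < j <= n)%N -> 0 < psum x j) (stay n x).
Proof.
apply: (iffP forallP) => [h [|j]//= jn|h j]; first exact: (h (Ordinal jn)).
by apply: h; rewrite /= ltn_ord.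
Qed.

Lemma blockP k x :
  reflect (0 < psum x k /\ forall j, (0 < j <= k)%N -> psum x k <= psum x j)
    (block k x).
Proof.
apply: (iffP andP) => -[x0 h]; split => //.
  move=> j /andP[j0]; rewrite leq_eqVlt => /predU1P[->//|jk].
  by have := forallP h (Ordinal jk); rewrite /= j0.
by apply/forallP => j; apply/implyP => j0; rewrite h// j0 ltnW.
Qed.

Lemma psum_shift k x n : psum (shift k x) n = psum x (k + n) - psum x k.
Proof. by rewrite /psum big_split_ord/= addrAC subrr add0r. Qed.

Lemma eq_psum n x y : (forall j, (j < n)%N -> x j = y j) -> psum x n = psum y n.
Proof. by move=> h; apply: eq_bigr => i _; exact: h. Qed.

Lemma eq_stay n x y : (forall j, (j < n)%N -> x j = y j) -> stay n x = stay n y.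
Proof.
move=> h; apply: eq_forallb => j; rewrite (@eq_psum _ x y)// => i ij.
by apply: h; exact: leq_trans ij _.
Qed.

Lemma eq_block n x y : (forall j, (j < n)%N -> x j = y j) -> block n x = block n y.
Proof.
move=> h; rewrite /block (eq_psum h); congr andb.
apply: eq_forallb => j; rewrite (@eq_psum j x y)// => i ij.
by apply: h; exact: ltn_trans ij _.
Qed.

Lemma first_cutP n k x : (k <= n)%N ->
  reflect [/\ 0 < psum x k, forall j, (0 < j <= k)%N -> psum x k <= psum x j &
     forall j, (k < j <= n)%N -> psum x k < psum x j] (first_cut n k x).
Proof.
move=> kn; apply: (iffP andP) => [[/blockP[k0 h1] /stayP h2]|[k0 h1 h2]].
  split=> // j /andP[kj jn].
  have := h2 (j - k)%N; rewrite psum_shift subr_gt0 subnKC ?(ltnW kj)//.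
  by apply; rewrite subn_gt0 kj leq_sub2r.
split; first exact/blockP.
apply/stayP => j /andP[j0 jn]; rewrite psum_shift subr_gt0 h2//.
by rewrite -[ltnLHS]addn0 ltn_add2l j0 -leq_subRL.
Qed.

Lemma first_cut_stay n k x : (k <= n)%N -> first_cut n k x -> stay n x.
Proof.
move=> kn /(first_cutP _ kn)[k0 h1 h2]; apply/stayP => j /andP[j0 jn].
have [jk|kj] := leqP j k; first by rewrite (lt_le_trans k0)// h1// j0.
by rewrite (lt_trans k0)// h2// kj.
Qed.

Lemma last_argmin (g : nat -> R) n : exists2 c, (c <= n)%N &
  forall j, (j <= n)%N -> g c <= g j /\ ((c < j)%N -> g c < g j).
Proof.
elim: n => [|n [c cn ih]]; first by exists 0%N => // -[].
have [gc|gc] := leP (g n.+1) (g c); [exists n.+1 => //|exists c; first exact: leqW].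
  move=> j; rewrite leq_eqVlt => /predU1P[->|jn]; first by rewrite ltnn.
  by split; [exact: le_trans gc (ih _ jn).1|rewrite ltnNge (ltnW jn)].
move=> j; rewrite leq_eqVlt => /predU1P[->|jn]; last exact: ih.
by split => [|_] //; exact: ltW.
Qed.

(** The unique k is the last time at which the minimum of the path over the
times 1, ..., n is attained. *)
Lemma first_cut_unique n x : (0 < n)%N -> stay n x ->
  exists2 c : 'I_n, first_cut n c.+1 x &
    forall k : 'I_n, first_cut n k.+1 x -> k = c.
Proof.
case: n => // n _ sx; have [c cn hc] := last_argmin (fun j => psum x j.+1) n.
have cn1 : (c < n.+1)%N by [].
have E : first_cut n.+1 c.+1 x.
  apply/first_cutP => //; split.
  - by apply/(stayP _ _ sx).
  - by move=> [|j]//= jc; apply: (hc j _).1; exact: leq_trans (jc : (j <= c)%N) cn.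
  - by move=> [|j]//= /andP[cj jn]; apply: (hc j _).2.
exists (Ordinal cn1) => //= k /(first_cutP _ (ltn_ord k))[k0 h1 h2].
apply/val_inj => /=; case: (ltngtP k c) => // [kc|ck].
- have := h2 c.+1; rewrite !ltnS kc cn => /(_ isT).
  by rewrite ltNge (hc k _).1// -ltnS.
- have := h1 c.+1 (leqW ck).
  by rewrite leNgt (hc k _).2// -ltnS.
Qed.

Lemma stay_first_cut n x : (0 < n)%N ->
  (stay n x : nat) = (\sum_(k < n) first_cut n k.+1 x)%N.
Proof.
move=> n0; have [sx|sx] := boolP (stay n x).
  have [c Ec uc] := first_cut_unique n0 sx.
  rewrite (bigD1 c)//= Ec big1// => k kc; apply/eqP; rewrite eqb0.
  by apply: contra kc => /uc ->.
rewrite big1// => k _; apply/eqP; rewrite eqb0.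
by apply: contra sx; exact: first_cut_stay.
Qed.

(** By [first_cut_unique] at most one term of this sum is nonzero: it is the
first cut, or 0 when the path does not stay positive. *)
Definition gap n x : nat := \sum_(k < n) k.+1 * first_cut n k.+1 x.

(** Steps of period n with positive sum over a period: the path then drifts to
infinity, and a time is a cut, a future minimum, as soon as the path stays
above its present value for one period. *)
Section cyclic.
Variables (n : nat) (x : nat -> R).
Hypotheses (n0 : (0 < n)%N) (xn : forall j, x (j + n)%N = x j).
Let cut i := stay n (shift i x).

Let psumDn i : psum x (i + n) = psum x i + psum x n.
Proof.
rewrite addnC /psum big_split_ord/= addrC; congr (_ + _).
by apply: eq_bigr => j _; rewrite addnC xn.
Qed.

Let cutDn i : cut (i + n) = cut i.
Proof.
by apply: eq_stay => j _; rewrite /shift addnAC xn.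
Qed.

Let cutP i : reflect (forall j, (0 < j <= n)%N -> psum x i < psum x (i + j)) (cut i).
Proof.
apply: (iffP (stayP _ _)) => h j jn; have := h j jn; by rewrite psum_shift subr_gt0.
Qed.

Hypothesis Sn : 0 < psum x n.

(** The last minimum over one period is a cut, as every period lifts the path
by a positive amount. *)
Lemma cut_exists : exists c, cut c.
Proof.
case: n n0 psumDn cutP Sn => // m _ psumDm cutPm Sm.
have [c cm hc] := last_argmin (psum x) m.
exists c; apply/cutPm => j /andP[j0 jm].
have [cj|cj] := leqP (c + j) m.
  by apply: (hc _ cj).2; rewrite -[ltnLHS]addn0 ltn_add2l.
rewrite -(subnK cj) psumDm (@le_lt_trans _ _ (psum x (c + j - m.+1)))//.
  by apply: (hc _ _).1; rewrite leq_subLR addSnnS leq_add.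
by rewrite ltrDl.
Qed.

Lemma cut_exists_from i : exists c, (i <= c)%N && cut c.
Proof.
have [c cc] := cut_exists; exists (c + i * n)%N; apply/andP; split.
  by rewrite (leq_trans (leq_pmulr i n0))// leq_addl.
elim: i => [|i ih]; first by rewrite addn0.
by rewrite mulSn addnCA addnC cutDn.
Qed.

Definition next_cut i := ex_minn (cut_exists_from i).

Lemma next_cutP i m : (i <= m)%N -> cut m ->
  (forall j, (i <= j < m)%N -> ~~ cut j) -> next_cut i = m.
Proof.
move=> im cm h; rewrite /next_cut; case: ex_minnP => k /andP[ik ck] hk.
apply/eqP; rewrite eqn_leq hk ?im ?cm//= leqNgt; apply/negP => km.
by have := h k; rewrite ik km ck => /(_ isT).
Qed.

Lemma next_cutDn i : next_cut (i + n) = (next_cut i + n)%N.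
Proof.
rewrite {2}/next_cut; case: ex_minnP => k /andP[ik ck] hk.
apply: next_cutP; rewrite ?leq_add2r ?cutDn// => j /andP[ij jk].
have nj : (n <= j)%N := leq_trans (leq_addl _ _) ij.
rewrite -(subnK nj) cutDn; apply/negP => cj.
have := hk (j - n)%N; rewrite cj andbT leq_subRL// addnC ij => /(_ isT).
by rewrite leqNgt ltn_subLR// addnC jk.
Qed.

(** If i is not a cut, both sides are the next cut after i.  If i is a cut, the
first cut k of the path started at i is the distance to the next cut: a time
strictly between i and i + k is followed by i + k, where the path is not
higher; and i + k is a cut because up to i + n the path stays above its value
at i + k, and the times after i + n are copies, lifted by the positive sum of a
period, of times in ]i, i + k], where the path is not below that value. *)
Lemma next_cut_gap i : next_cut i.+1 = (next_cut i + gap n (shift i x))%N.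
Proof.
have [ci|ci] := boolP (cut i); last first.
  rewrite /gap big1 ?addn0; last first.
    move=> k _; apply/eqP; rewrite muln_eq0/= eqb0.
    by apply: contra ci; exact: first_cut_stay.
  rewrite {2}/next_cut; case: ex_minnP => k /andP[ik ck] hk.
  apply: next_cutP => //.
    by move: ik; rewrite leq_eqVlt => /predU1P[ik|//]; rewrite -ik (negbTE ci) in ck.
  move=> j /andP[ij jk]; apply/negP => cj.
  by have := hk j; rewrite (ltnW ij) cj leqNgt jk => /(_ isT).
have -> : next_cut i = i.
  by apply: next_cutP => // j /andP[]; case: ltngtP.
have [c Ec uc] := first_cut_unique n0 ci.
rewrite /gap (bigD1 c)//= Ec muln1 big1 ?addn0; last first.
  move=> k kc; apply/eqP; rewrite muln_eq0/= eqb0.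
  by apply: contra kc => /uc ->.
have [k0 h1 h2] := first_cutP _ (ltn_ord c) Ec.
have h1' j : (i < j <= i + c.+1)%N -> psum x (i + c.+1) <= psum x j.
  move=> /andP[ij jc]; have := h1 (j - i)%N.
  rewrite !psum_shift lerD2r subnKC ?(ltnW ij)// subn_gt0 ij leq_subLR jc; exact.
have h2' j : (i + c.+1 < j <= i + n)%N -> psum x (i + c.+1) < psum x j.
  move=> /andP[ij jc]; have := h2 (j - i)%N.
  rewrite !psum_shift ltrD2r subnKC; last exact: leq_trans (leq_addr _ _) (ltnW ij).
  by rewrite ltn_subRL ij leq_subLR jc => ->.
apply: next_cutP => //.
- by rewrite addnS ltnS leq_addr.
- apply/cutP => j /andP[j0 jn].
  have [jle|jgt] := leqP (i + c.+1 + j) (i + n).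
    by apply: h2'; rewrite jle andbT -[ltnLHS]addn0 ltn_add2l.
  have nle : (n <= i + c.+1 + j)%N by rewrite ltnW// (leq_ltn_trans _ jgt)// leq_addl.
  rewrite -(subnK nle) psumDn (@le_lt_trans _ _ (psum x (i + c.+1 + j - n)))// ?ltrDl//.
  by apply: h1'; rewrite ltn_subRL addnC jgt leq_subLR addnC leq_add2r jn.
- move=> j /andP[ij jc]; apply/negP => /cutP /(_ (i + c.+1 - j)%N).
  rewrite subnKC ?(ltnW jc)// subn_gt0 jc => /=.
  rewrite ltNge h1' ?ij ?(ltnW jc)// => /(_ _)/negP; apply => //.
  by rewrite leq_subLR leq_add// ltnW.
Qed.

(** Telescoping: the gaps move the next cut of 0 to the next cut of n. *)
Lemma sum_gap : (\sum_(i < n) gap n (shift i x))%N = n.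
Proof.
have H m : (next_cut 0 + \sum_(i < m) gap n (shift i x))%N = next_cut m.
  elim: m => [|m ih]; first by rewrite big_ord0 addn0.
  by rewrite big_ord_recr/= addnA ih -next_cut_gap.
by apply/(@addnI (next_cut 0)); rewrite H -[X in next_cut X]add0n next_cutDn.
Qed.

End cyclic.

(** When the total is nonpositive every rotation has the same nonpositive
total, so that none of them stays positive and all the gaps vanish. *)
Lemma sum_cyclic_gap n x : (0 < n)%N ->
  (\sum_(i < n) gap n (fun j => x ((i + j) %% n)))%N = (n * (0 < psum x n)%R)%N.
Proof.
move=> n0; pose y j := x (j %% n)%N.
have yn j : y (j + n)%N = y j by rewrite /y modnDr.
have <- : psum y n = psum x n by apply: eq_psum => j jn; rewrite /y modn_small.
have [Sn|Sn] := ltP 0 (psum y n); first by rewrite muln1 -[RHS](sum_gap n0 yn Sn).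
rewrite muln0 big1// => i _; rewrite /gap big1// => k _.
apply/eqP; rewrite muln_eq0/= eqb0; apply/negP => /(first_cut_stay (ltn_ord k)).
move=> /stayP /(_ n); rewrite n0 leqnn => /(_ isT).
rewrite ltNge => /negP; apply.
have -> : psum (fun j => x ((i + j) %% n)%N) n = psum y n => //.
transitivity (psum y (i + n) - psum y i); first by rewrite -psum_shift.
rewrite addnC /psum big_split_ord/= -addrA.
rewrite [X in X - _](_ : _ = psum y i) ?subrr ?addr0//.
by apply: eq_bigr => j _; rewrite addnC yn.
Qed.

End paths.

(** * Laws of finite tuples of steps *)

Section rectangles.
Context d (T : measurableType d) (n : nat).

Definition rectangles : set (set (n.-tuple T)) :=
  [set A | exists2 B : 'I_n -> set T, forall i, measurable (B i) &
     A = [set t | forall i, B i (tnth t i)]].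

Lemma rectangles_measurable : rectangles `<=` measurable.
Proof.
move=> _ [B mB ->].
rewrite (_ : mkset _ = \bigcap_(i in [set: 'I_n])
    ((fun t : n.-tuple T => tnth t i) @^-1` B i)); last first.
  by apply/seteqP; split => t /= h i; [move=> _|]; exact: h.
apply: fin_bigcap_measurable; first exact: finite_finset.
by move=> i _; rewrite -[X in measurable X]setTI; exact: measurable_tnth.
Qed.

Lemma rectangles_setI : setI_closed rectangles.
Proof.
move=> _ _ [B mB ->] [C mC ->]; exists (fun i => B i `&` C i).
  by move=> i; exact: measurableI.
apply/seteqP; split => t /=; first by move=> [hB hC] i; split.
by move=> h; split => i; have [] := h i.
Qed.

Lemma rectangles_setT : rectangles [set: n.-tuple T].
Proof. by exists (fun=> setT) => //; apply/seteqP; split. Qed.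

Lemma measurable_rectangles : @measurable _ (n.-tuple T) = <<s rectangles >>.
Proof.
apply/seteqP; split; last first.
  apply: smallest_sub; [exact: sigma_algebra_measurable|exact: rectangles_measurable].
apply: smallest_sub; first exact: smallest_sigma_algebra.
rewrite -bigcup_seq => A [i _ [B mB <-]]; apply: sub_sigma_algebra.
exists (fun j => if j == i then B else setT); first by move=> j; case: ifP.
apply/seteqP; split => t /=.
  by move=> [_ Bt] j; case: eqP => // ->.
by move=> h; split=> //; have := h i; rewrite eqxx.
Qed.

End rectangles.

Arguments rectangles {d T n}.

Section law.
Context d d' (T : measurableType d) (T' : measurableType d') (R : realType) (n : nat).
Variables (m1 m2 : {measure set T -> \bar R}) (f1 f2 : T -> n.-tuple T').

(** Dynkin's theorem for images under two maps: the rectangles are stable under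
intersection and generate the sigma-algebra of tuples. *)
Lemma rectangles_unique : measurable_fun setT f1 -> measurable_fun setT f2 ->
  (m1 setT < +oo)%E ->
  (forall A, rectangles A -> m1 (f1 @^-1` A) = m2 (f2 @^-1` A)) ->
  forall A, measurable A -> m1 (f1 @^-1` A) = m2 (f2 @^-1` A).
Proof.
move=> mf1 mf2 foo h A mA.
have c : \bigcup_(k in [set: nat]) [set: n.-tuple T'] = setT.
  by rewrite bigcup_const//; exists 0%N.
apply: (measure_unique rectangles (fun=> setT) _ _ _ c
  (pushforward m1 f1) (pushforward m2 f2)) => //.
- exact: measurable_rectangles.
- exact: rectangles_setI.
- by move=> _; exact: rectangles_setT.
Qed.

End law.

(** For E fixed, both sides are finite measures in A: the restriction of P to E
and a multiple of P, both carried over to tuples by f. *)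
Lemma independent_of_rectangles d d' (T : measurableType d) (T' : measurableType d')
    (R : realType) (P : probability T R) n (f : T -> n.-tuple T') (E : set T) :
  measurable_fun setT f -> measurable E ->
  (forall A, rectangles A -> P (f @^-1` A `&` E) = (P (f @^-1` A) * P E)%E) ->
  forall A, measurable A -> P (f @^-1` A `&` E) = (P (f @^-1` A) * P E)%E.
Proof.
move=> mf mE h A mA.
have PE_ge0 : 0 <= fine (P E) by rewrite fine_ge0.
have PEE : (fine (P E))%:E = P E by rewrite fineK// fin_num_measure.
have scaleE B : mscale (NngNum PE_ge0) P B = (P B * P E)%E.
  by rewrite /mscale/= PEE muleC.
rewrite -scaleE; apply: (@rectangles_unique _ _ _ _ _ _ (mrestr P mE)) => //.
  by rewrite /= /mrestr setTI ltey_eq fin_num_measure.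
by move=> B rB; rewrite [RHS]scaleE -h.
Qed.

Section finite_laws.
Context d (T : measurableType d) (R : realType) (P : probability T R)
  (X : nat -> {RV P >-> R}).
Hypotheses (indep : mutually_independent X) (ident : identically_distributed X).

Definition obs n (s : 'I_n -> nat) (w : T) : n.-tuple R := [tuple X (s i) w | i < n].

Lemma measurable_obs n (s : 'I_n -> nat) : measurable_fun setT (obs s).
Proof.
apply/measurable_fun_tnthP => i.
rewrite (_ : _ \o _ = X (s i)); first exact: measurable_funPT.
by apply/funext => w; rewrite /= tnth_mktuple.
Qed.

Lemma measurable_obs_preimage n (s : 'I_n -> nat) A :
  measurable A -> measurable (obs s @^-1` A).
Proof. by move=> mA; rewrite -[X in measurable X]setTI; exact: measurable_obs. Qed.

(** Independence and identical distribution together: the probability of a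
rectangle depends neither on the indices of the steps nor on their order. *)
Lemma rectangle_prob n (s : 'I_n -> nat) (B : 'I_n -> set R) : injective s ->
  (forall i, measurable (B i)) ->
  P (obs s @^-1` [set t | forall i, B i (tnth t i)]) =
  (\prod_(i < n) P (X 0 @^-1` B i))%E.
Proof.
move=> sI mB.
pose B' v := if [pick i | s i == v] is Some i then B i else setT.
have B's i : B' (s i) = B i.
  by rewrite /B'; case: pickP => [j /eqP/sI->//|/(_ i)]; rewrite eqxx.
have mB' v : measurable (B' v) by rewrite /B'; case: pickP.
have JU : uniq [seq s i | i <- enum 'I_n] by rewrite map_inj_uniq ?enum_uniq.
have := indep JU mB'; rewrite big_map big_enum/=.
rewrite (_ : \bigcap_(i in _) _ =
    obs s @^-1` [set t | forall i, B i (tnth t i)]); last first.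
  apply/seteqP; split => w /= h i.
    by rewrite tnth_mktuple -B's; apply: h => /=; rewrite map_f// mem_enum.
  by move=> /mapP[j _ ->]; rewrite B's; have := h j; rewrite tnth_mktuple.
by move=> ->; apply: eq_bigr => i _; rewrite B's; exact: (ident (s i) 0%N).
Qed.

Lemma exchangeable n (s t : 'I_n -> nat) A :
  injective s -> injective t -> measurable A ->
  P (obs s @^-1` A) = P (obs t @^-1` A).
Proof.
move=> sI tI mA; apply: rectangles_unique => //; try exact: measurable_obs.
  by rewrite ltey_eq fin_num_measure.
move=> _ [B mB ->].
exact: etrans (rectangle_prob sI mB) (esym (rectangle_prob tI mB)).
Qed.

(** Rectangles for the two blocks form a rectangle for the concatenated block;
[independent_of_rectangles] is then applied to one block after the other. *)
Lemma independent_blocks n m (s : 'I_n -> nat) (t : 'I_m -> nat) A C :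
  injective s -> injective t -> (forall i j, s i != t j) ->
  measurable A -> measurable C ->
  P (obs s @^-1` A `&` obs t @^-1` C) = (P (obs s @^-1` A) * P (obs t @^-1` C))%E.
Proof.
move=> sI tI st mA mC.
(* Reduction to a rectangle A, with C an arbitrary measurable set. *)
apply: (independent_of_rectangles (measurable_obs s)
  (measurable_obs_preimage t mC)) => //.
move=> {mA} A rA; have mA := rectangles_measurable rA.
rewrite setIC [RHS]muleC.
(* Reduction to a rectangle C as well. *)
apply: (independent_of_rectangles (measurable_obs t)
  (measurable_obs_preimage s mA)) => //.
move=> {mC} C rC; case: rA rC => [B mB ->] [D mD ->].
rewrite !rectangle_prob// setIC [RHS]muleC.
pose st' (i : 'I_(n + m)) :=
  match fintype.split i with inl i => s i | inr j => t j end.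
pose BD (i : 'I_(n + m)) :=
  match fintype.split i with inl i => B i | inr j => D j end.
have stI : injective st'.
  move=> i j; rewrite /st' => ij; rewrite -(splitK i) -(splitK j); move: ij.
  case: (fintype.split i) (fintype.split j) => [i'|i'] [j'|j'].
  - by move=> /sI ->.
  - by move=> /eqP; rewrite (negbTE (st _ _)).
  - by move=> /eqP; rewrite eq_sym (negbTE (st _ _)).
  - by move=> /tI ->.
have mBD i : measurable (BD i) by rewrite /BD; case: fintype.split.
have := rectangle_prob stI mBD; rewrite big_split_ord/=.
under eq_bigr do rewrite /BD (unsplitK (inl _)).
under [X in (_ * X)%E]eq_bigr do rewrite /BD (unsplitK (inr _)).
move=> <-; congr (P _); apply/seteqP; split => w /=.
  by move=> [h1 h2] i; rewrite tnth_mktuple /st' /BD; case: fintype.split => j;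
    [have := h1 j|have := h2 j]; rewrite tnth_mktuple.
move=> h; split => i.
  by have := h (lshift m i); rewrite !tnth_mktuple /st' /BD (unsplitK (inl _)).
by have := h (rshift n i); rewrite !tnth_mktuple /st' /BD (unsplitK (inr _)).
Qed.

End finite_laws.

(** * Measurability and counting of path events *)

Section measurability.
Context d (T : measurableType d) (R : realType).
Implicit Type y : T -> nat -> R.

Lemma measurable_bool_set (b : T -> bool) :
  measurable_fun setT b -> measurable [set w | b w].
Proof.
by move=> mb; rewrite -[X in measurable X]setTI; apply: (mb _ [set true]).
Qed.

Lemma measurable_forall_ord n (b : 'I_n -> T -> bool) :
  (forall i, measurable_fun setT (b i)) ->
  measurable_fun setT (fun w => [forall i, b i w]).
Proof.
move=> mb; apply: (measurable_fun_bool true); rewrite setTI.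
rewrite (_ : _ @^-1` _ = \bigcap_(i in [set: 'I_n]) [set w | b i w]).
  apply: fin_bigcap_measurable; first exact: finite_finset.
  by move=> i _; exact: measurable_bool_set.
apply/seteqP; split => w /=; first by move=> /forallP h i _; exact: h.
by move=> h; apply/forallP => i; exact: h.
Qed.

Lemma measurable_psum y k : (forall j, measurable_fun setT (y ^~ j)) ->
  measurable_fun setT (fun w => psum (y w) k).
Proof. by move=> my; apply: measurable_sum => j; exact: my. Qed.

Lemma measurable_stay y n : (forall j, measurable_fun setT (y ^~ j)) ->
  measurable_fun setT (fun w => stay n (y w)).
Proof.
move=> my; apply: measurable_forall_ord => j.
by apply: measurable_fun_ltr; [exact: measurable_cst|exact: measurable_psum].
Qed.

Lemma measurable_block y k : (forall j, measurable_fun setT (y ^~ j)) ->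
  measurable_fun setT (fun w => block k (y w)).
Proof.
move=> my; apply: measurable_and.
  by apply: measurable_fun_ltr; [exact: measurable_cst|exact: measurable_psum].
apply: measurable_forall_ord => -[[|j] jk]; first exact: measurable_cst.
by apply: measurable_fun_ler; exact: measurable_psum.
Qed.

Lemma measurable_first_cut y n k : (forall j, measurable_fun setT (y ^~ j)) ->
  measurable_fun setT (fun w => first_cut n k (y w)).
Proof.
move=> my; apply: measurable_and; first exact: measurable_block.
by apply: measurable_stay => j; exact: my.
Qed.

End measurability.

Lemma measurable_nth (R : realType) n j :
  measurable_fun [set: n.-tuple R] (fun t : n.-tuple R => nth 0 t j).
Proof.
have [jn|jn] := ltnP j n.
  rewrite (_ : (fun _ => _) = fun t : n.-tuple R => tnth t (Ordinal jn)).
    exact: measurable_tnth.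
  by apply/funext => t; rewrite (tnth_nth 0).
rewrite (_ : (fun _ => _) = cst 0); first exact: measurable_cst.
by apply/funext => t; rewrite nth_default// size_tuple.
Qed.

(** Pointwise identities between weighted numbers of events are turned into
identities between probabilities by expressing both as integrals. *)
Lemma integral_sum_events d (T : measurableType d) (R : realType) (P : probability T R)
    (I : finType) (c : I -> nat) (A : I -> T -> bool) :
  (forall i, measurable_fun setT (A i)) ->
  (\int[P]_w (\sum_i c i * A i w)%N%:R%:E =
   \sum_i (c i)%:R%:E * P [set w | A i w])%E.
Proof.
move=> mA.
have mAs i : measurable [set w | A i w] by exact: measurable_bool_set.
transitivity (\int[P]_w (\sum_(i <- index_enum I)
    (c i)%:R%:E * (\1_[set w | A i w] w)%:E))%E.
  apply: eq_integral => w _; rewrite natr_sum -sumEFin; apply: eq_bigr => i _.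
  rewrite natrM EFinM indicE; congr (_ * _%:R%:E)%E.
  by case: (boolP (A i w)) => h; [rewrite mem_set|rewrite memNset//; exact/negP].
rewrite ge0_integral_sum//.
- apply: eq_bigr => i _; rewrite ge0_integralZl//.
  + by rewrite integral_indic// setIT.
  + by apply/measurable_EFinP; exact: measurable_indic.
- move=> i; apply: measurable_funeM.
  by apply/measurable_EFinP; exact: measurable_indic.
Qed.

(** * Recurrence for the probability of staying positive *)

Section renewal.
Context {R : comNzRingType}.

(** In the convolution algebra of sequences, with D u = (n u n)_n, the
hypotheses say p = 1 + f * p and a = D f * p, and the conclusion D p = a * p.
By induction on n: D p = D f * p + f * D p = a + f * (a * p), where f 0 = 0
lets the induction hypothesis replace D p by a * p; and
a + a * (f * p) = a + a * (p - 1) = a * p. *)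
Lemma renewal_derivative (f p a : nat -> R) :
  p 0%N = 1 -> f 0%N = 0 ->
  (forall n, (0 < n)%N -> p n = \sum_(k < n.+1) f k * p (n - k)%N) ->
  (forall n, a n = \sum_(k < n.+1) k%:R * f k * p (n - k)%N) ->
  forall n, n%:R * p n = \sum_(k < n.+1) a k * p (n - k)%N.
Proof.
move=> p0 f0 pE aE n; elim/ltn_ind: n => n ih.
case: (posnP n) => [->|n0].
  by rewrite mul0r big_ord1 aE big_ord1 mul0r !mul0r.
(* Polynomials provide the associativity of the convolution, up to degree n. *)
pose F := \poly_(i < n.+1) f i; pose Q := \poly_(i < n.+1) p i.
pose A := \poly_(i < n.+1) a i.
have tr (u v : nat -> R) m : (m <= n)%N ->
    (\poly_(i < n.+1) u i * \poly_(i < n.+1) v i)`_m =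
    \sum_(k < m.+1) u k * v (m - k)%N.
  move=> mn; rewrite coefM; apply: eq_bigr => k _.
  rewrite !coef_poly !ltnS (leq_trans _ mn); last by rewrite -ltnS.
  by rewrite (leq_trans (leq_subr _ _) mn).
have FQ m : (m <= n)%N -> (F * Q)`_m = p m - (m == 0%N)%:R.
  move=> mn; rewrite tr//; case: m mn => [|m] mn; last by rewrite -pE// subr0.
  by rewrite big_ord1 f0 mul0r p0 subrr.
have -> : n%:R * p n = a n + (F * (A * Q))`_n.
  rewrite [in LHS]pE// mulr_sumr aE coefM -big_split/=; apply: eq_bigr => k _.
  have kn : (k <= n)%N by rewrite -ltnS.
  rewrite coef_poly ltn_ord tr ?leq_subr//.
  case: (posnP k) => [->|k0]; first by rewrite f0 !(mul0r, mulr0) addr0.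
  rewrite -ih ?ltn_subrL ?k0// natrB//.
  by rewrite mulrBl mulrBr !mulrA [k%:R * _]mulrC [f k * n%:R]mulrC addrC subrK.
have -> : (F * (A * Q))`_n = (A * (F * Q))`_n by rewrite mulrCA.
rewrite coefM -tr// coefM.
rewrite !big_ord_recr/= !subnn FQ// eqxx p0 subrr mulr0 addr0 coef_poly ltnSn.
rewrite [in RHS]coef_poly/= p0 mulr1 addrC; congr (_ + _).
apply: eq_bigr => k _; rewrite FQ ?leq_subr// subn_eq0 leqNgt ltn_ord subr0.
by rewrite [X in _ = _ * X]coef_poly ltnS leq_subr.
Qed.

End renewal.

Lemma lt_tau0 (T : Type) (R : realType) (X : nat -> T -> R) n w :
  (n%:R%:E < tau0 X w)%E = stay n (X ^~ w).
Proof.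
apply/idP/stayP => [h j /andP[j0 jn]|h].
  rewrite ltNge; apply/negP => Sj.
  have : (tau0 X w <= j%:R%:E)%E by apply: ereal_inf_lbound; exists j.
  by apply/negP; rewrite -ltNge (le_lt_trans _ h)// lee_fin ler_nat.
apply: (@lt_le_trans _ _ n.+1%:R%:E); first by rewrite lte_fin ltr_nat.
apply: le_ereal_inf_tmp => _ [m [m0 Sm] <-]; rewrite lee_fin ler_nat ltnNge.
by apply/negP => mn; have := h m; rewrite m0 mn => /(_ isT); rewrite ltNge Sm.
Qed.

Section iid.
Context d (T : measurableType d) (R : realType) (P : probability T R)
  (X : nat -> {RV P >-> R}).
Hypotheses (indep : mutually_independent X) (ident : identically_distributed X).

(** Measurability is required on n-tuples, where the laws of finitely many steps
live; the tuple is completed to a sequence by zeros. *)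
Definition depends_on_first n (F : (nat -> R) -> bool) :=
  (forall x y, (forall j, (j < n)%N -> x j = y j) -> F x = F y) /\
  measurable [set t : n.-tuple R | F (nth 0 t)].

Lemma obs_preimage n F (s : nat -> nat) : depends_on_first n F ->
  [set w | F (fun j => X (s j) w)] =
  obs X (fun i : 'I_n => s i) @^-1` [set t | F (nth 0 t)].
Proof.
move=> [Fn _]; apply/funext => w; apply/propext; rewrite /=.
rewrite (Fn _ (nth 0 (obs X (fun i : 'I_n => s i) w)))// => j jn.
have := tnth_nth 0 (obs X (fun i : 'I_n => s i) w) (Ordinal jn).
by rewrite tnth_mktuple.
Qed.

Lemma prob_reindex n F (s t : nat -> nat) : depends_on_first n F ->
  {in [pred j | (j < n)%N] &, injective s} ->
  {in [pred j | (j < n)%N] &, injective t} ->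
  P [set w | F (fun j => X (s j) w)] = P [set w | F (fun j => X (t j) w)].
Proof.
move=> dF sI tI; rewrite !(obs_preimage _ dF).
apply: (exchangeable indep ident); last exact: dF.2.
  by move=> i j /sI ij; apply/val_inj/ij; exact: ltn_ord.
by move=> i j /tI ij; apply/val_inj/ij; exact: ltn_ord.
Qed.

Lemma depends_stay n : depends_on_first n (stay n).
Proof.
split; first exact: eq_stay.
by apply: measurable_bool_set; apply: measurable_stay; exact: measurable_nth.
Qed.

Lemma depends_block n : depends_on_first n (block n).
Proof.
split; first exact: eq_block.
by apply: measurable_bool_set; apply: measurable_block; exact: measurable_nth.
Qed.

Lemma depends_first_cut n k : (k <= n)%N -> depends_on_first n (first_cut n k).
Proof.
move=> kn; split; last first.
  by apply: measurable_bool_set; apply: measurable_first_cut; exact: measurable_nth.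
move=> x y xy; rewrite /first_cut (@eq_block _ _ x y) => [|j jk]; last first.
  by apply: xy; exact: leq_trans jk kn.
congr (_ && _); apply: eq_stay => j jnk; apply: xy.
by rewrite -ltn_subRL.
Qed.

Definition stay_prob n := fine (P [set w | stay n (X ^~ w)]).
Definition block_prob n := fine (P [set w | block n (X ^~ w)]).
Definition positive_prob n := fine (P [set w | 0 < walk X n w]).
Notation p := stay_prob.
Notation f := block_prob.
Notation a := positive_prob.

Let mX j : measurable_fun setT (X j). Proof. exact: measurable_funPT. Qed.

Let finite_event (b : T -> bool) : measurable_fun setT b ->
  P [set w | b w] = (fine (P [set w | b w]))%:E.
Proof.
by move=> mb; rewrite fineK// fin_num_measure//; exact: measurable_bool_set.
Qed.

Lemma stay_probE n : P [set w | stay n (X ^~ w)] = (p n)%:E.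
Proof. by apply: finite_event; exact: measurable_stay. Qed.

Let positive_probE n : P [set w | 0 < walk X n w] = (a n)%:E.
Proof.
apply: finite_event; apply: measurable_fun_ltr => //.
exact: (@measurable_psum _ _ _ (fun w => X ^~ w)).
Qed.

(** The block uses the steps before k and the sequel the steps from k on, and
the sequel has the law of the first n - k steps. *)
Lemma prob_first_cut n k : (k <= n)%N ->
  P [set w | first_cut n k (X ^~ w)] = (f k * p (n - k)%N)%:E.
Proof.
move=> kn; rewrite EFinM -stay_probE -(finite_event (measurable_block _ mX)).
rewrite (_ : mkset _ = [set w | block k (X ^~ w)] `&`
    [set w | stay (n - k) (fun j => X (k + j)%N w)]); last first.
  by apply/seteqP; split => w /andP.
rewrite -(prob_reindex (depends_stay (n - k)) (s := addn k) (t := id)); last first.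
- by [].
- by move=> i j _ _ /addnI.
rewrite (obs_preimage id (depends_block k)).
rewrite (obs_preimage (addn k) (depends_stay (n - k))).
apply: (independent_blocks indep ident).
- by move=> i j /val_inj.
- by move=> i j /addnI/val_inj.
- by move=> i j; rewrite neq_ltn (leq_trans (ltn_ord i))// leq_addr.
- exact: (depends_block k).2.
- exact: (depends_stay (n - k)).2.
Qed.

Lemma renewal_stay n : (0 < n)%N -> p n = \sum_(k < n) f k.+1 * p (n - k.+1)%N.
Proof.
move=> n0; apply: EFin_inj; rewrite -stay_probE -sumEFin.
have := @integral_sum_events _ _ _ P 'I_1 (fun=> 1%N)
  (fun _ w => stay n (X ^~ w)).
rewrite big_ord1 mul1e => <-; last by move=> _; exact: measurable_stay.
under eq_integral => w _ do rewrite big_ord1 /= mul1n stay_first_cut//.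
transitivity (\int[P]_w (\sum_(k < n) 1 * first_cut n k.+1 (X ^~ w))%N%:R%:E)%E.
  apply: eq_integral => w _; congr (_%:R%:E).
  by apply: eq_bigr => k _; rewrite mul1n.
rewrite (@integral_sum_events _ _ _ P 'I_n (fun=> 1%N)
  (fun k w => first_cut n k.+1 (X ^~ w))).
  2: by move=> k; exact: measurable_first_cut.
by apply: eq_bigr => k _; rewrite mul1e prob_first_cut.
Qed.

(** Expectation of [sum_cyclic_gap]: each of the n rotations contributes the
mean length of the first block of a path that stays positive. *)
Lemma cyclic_block_length n : (0 < n)%N ->
  a n = \sum_(k < n) k.+1%:R * f k.+1 * p (n - k.+1)%N.
Proof.
move=> n0.
have nR : n%:R != 0 :> R by rewrite pnatr_eq0 -lt0n.
apply: (mulfI nR); apply: EFin_inj; rewrite EFinM -positive_probE.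
have := @integral_sum_events _ _ _ P 'I_1 (fun=> n)
  (fun _ w => 0 < psum (X ^~ w) n).
rewrite big_ord1 => <-; last first.
  move=> _; apply: measurable_fun_ltr; first exact: measurable_cst.
  exact: measurable_psum.
pose A (ik : 'I_n * 'I_n) w :=
  first_cut n ik.2.+1 (fun j => X ((ik.1 + j) %% n)%N w).
transitivity (\int[P]_w (\sum_(ik : 'I_n * 'I_n) ik.2.+1 * A ik w)%N%:R%:E)%E.
  apply: eq_integral => w _; congr (_%:R%:E).
  by rewrite big_ord1 -sum_cyclic_gap// /gap pair_bigA.
rewrite (@integral_sum_events _ _ _ P ('I_n * 'I_n)%type (fun ik => ik.2.+1) A).
  2: by move=> ik; apply: measurable_first_cut => j.
pose g (i k : 'I_n) := (k.+1%:R * f k.+1 * p (n - k.+1)%N)%:E.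
transitivity (\sum_(ik : 'I_n * 'I_n) g ik.1 ik.2)%E.
  apply: eq_bigr => -[i k] _; rewrite /g /= -mulrA EFinM; congr (_ * _)%E.
  rewrite -prob_first_cut//.
  apply: (prob_reindex (depends_first_cut (ltn_ord k)) (t := id)) => //.
  by move=> j1 j2 j1n j2n /eqP; rewrite eqn_modDl !modn_small// => /eqP.
rewrite -(pair_bigA _ g)/=.
have -> (S : R) : n%:R * S = \sum_(i < n) S.
  by rewrite sumr_const card_ord mulr_natl.
rewrite -sumEFin; apply: eq_bigr => i _; rewrite -sumEFin; exact: eq_bigr.
Qed.

Lemma positive_prob_itv n : 0 <= a n <= 1.
Proof.
rewrite fine_ge0//= -lee_fin -positive_probE; apply: probability_le1.
apply: measurable_bool_set; apply: measurable_fun_ltr => //.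
exact: (@measurable_psum _ _ _ (fun w => X ^~ w)).
Qed.

Lemma stay_prob0 : p 0%N = 1.
Proof.
rewrite /stay_prob (_ : mkset _ = setT) ?probability_setT//.
by apply/seteqP; split => w // _; apply/forallP => -[].
Qed.

Lemma spitzer_recurrence n : n%:R * p n = \sum_(k < n) a (n - k)%N * p k.
Proof.
have F0 (b : T -> bool) : b =1 xpred0 -> fine (P [set w | b w]) = 0.
  move=> b0; rewrite (_ : mkset _ = set0) ?measure0//.
  by apply/seteqP; split => w //=; rewrite b0.
have f0 : f 0%N = 0 by apply: F0 => w; rewrite /block /psum big_ord0 ltxx.
have a0 : a 0%N = 0 by apply: F0 => w; rewrite /walk big_ord0 ltxx.
have H := @renewal_derivative R f p a stay_prob0 f0 _ _ n.
rewrite H => [|{H}n n0|{H}n].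
- rewrite big_ord_recl a0 mul0r add0r (reindex_inj rev_ord_inj)/=.
  by apply: eq_bigr => k _; rewrite /bump/= add1n subnSK// subKn// ltnW.
- by rewrite renewal_stay// big_ord_recl f0 mul0r add0r.
- case: n => [|n]; first by rewrite a0 big_ord1 !mul0r.
  by rewrite cyclic_block_length// [RHS]big_ord_recl !mul0r add0r.
Qed.

Lemma stay_prob_nonincreasing : {homo p : m n / (m <= n)%N >-> n <= m}.
Proof.
move=> m n mn; apply: fine_le; rewrite ?fin_num_measure//;
  try by apply: measurable_bool_set; exact: measurable_stay.
apply: le_measure; rewrite ?inE;
  try by apply: measurable_bool_set; exact: measurable_stay.
move=> w /stayP h; apply/stayP => j /andP[j0 jm]; apply: h.
by rewrite j0 (leq_trans jm mn).
Qed.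

End iid.

(** * Regular variation from the recurrence *)

Section regular_variation.
Context {R : realType}.
Implicit Types (p a W : nat -> R).

Lemma nonincreasing_le_average p n k : (forall n, 0 < p n) ->
  {homo p : m n / (m <= n)%N >-> n <= m} -> (k < n)%N ->
  p k <= (\sum_(i < n) p i) / k.+1%:R.
Proof.
move=> p0 pd kn; rewrite ler_pdivlMr ?ltr0n// mulr_natr.
rewrite -(big_mkord predT p) (big_cat_nat _ kn)//= -[leLHS]addr0 lerD//.
  rewrite big_mkord -[X in _ *+ X]card_ord -sumr_const ler_sum// => i _.
  by apply: pd; rewrite -ltnS.
by rewrite sumr_ge0// => i _; exact: ltW.
Qed.

(** The difference n p n - rho U n is the sum of the (a (n - k) - rho) p k.
For n - k beyond a fixed K the factors are small and the p k add up to at most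
U n; the remaining K terms are at most U n / (n - K) each, by
[nonincreasing_le_average]. *)
Lemma cvg_ratio_partial_sum p a rho :
  (forall n, 0 < p n) -> {homo p : m n / (m <= n)%N >-> n <= m} ->
  (forall n, `|a n - rho| <= 1) -> a n @[n --> \oo] --> rho ->
  (forall n, n%:R * p n = \sum_(k < n) a (n - k)%N * p k) ->
  n%:R * p n / (\sum_(k < n) p k) @[n --> \oo] --> rho.
Proof.
move=> p0 pd a1 acv rec; apply/cvgrPdist_le => e e0.
have e20 : 0 < e / 2 by lra.
have /cvgrPdist_le /(_ _ e20) [K _ HK] := acv.
near=> n.
have nK : (K < n)%N by near: n; exists K.+1.
set U := \sum_(k < n) p k.
have U0 : 0 < U.
  have n0 : (0 < n)%N by exact: leq_ltn_trans nK.
  rewrite /U -(prednK n0) big_ord_recl ltr_wpDr// sumr_ge0// => i _; exact: ltW.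
have D : n%:R * p n / U - rho = (\sum_(k < n) (a (n - k)%N - rho) * p k) / U.
  have U1 : U != 0 by rewrite gt_eqF.
  rewrite rec; under [in RHS]eq_bigr do rewrite mulrBl.
  by rewrite big_split /= sumrN -mulr_sumr -/U; field.
rewrite distrC D normrM normfV (gtr0_norm U0) ler_pdivrMr//.
apply: le_trans (ler_norm_sum _ _ _) _.
have step k : (k < n)%N -> `|(a (n - k)%N - rho) * p k| <= e / 2 * p k +
   (if (n - K <= k)%N then U / (n - K)%:R else 0).
  move=> kn; rewrite normrM (gtr0_norm (p0 k)); case: ifPn => kK.
    rewrite -[leLHS]add0r lerD//; first by rewrite mulr_ge0 ?ltW.
    apply: (@le_trans _ _ (p k)); first by rewrite ler_piMl// ltW.
    apply: le_trans (nonincreasing_le_average p0 pd kn) _.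
    rewrite ler_pM2l// lef_pV2 ?posrE ?ltr0n ?subn_gt0// ler_nat; lia.
  rewrite addr0 ler_pM2r// distrC HK//=; lia.
apply: (@le_trans _ _ (\sum_(k < n) (e / 2 * p k +
   (if (n - K <= k)%N then U / (n - K)%:R else 0)))).
  by apply: ler_sum => k _; exact: step.
rewrite big_split/= -mulr_sumr -/U.
suff : \sum_(k < n) (if (n - K <= k)%N then U / (n - K)%:R else 0) <= e / 2 * U.
  by lra.
rewrite -(big_mkord predT (fun k => if (n - K <= k)%N then _ else _)).
rewrite (big_cat_nat (n := (n - K)%N))//= ?leq_subr//.
rewrite big_nat_cond big1 ?add0r; last first.
  by move=> i; rewrite andbT => /andP[_ ?]; rewrite leqNgt ifN// negbK.
rewrite (eq_big_nat _ _ (F2 := fun=> U / (n - K)%:R)); last first.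
  by move=> i /andP[->].
rewrite sumr_const_nat subKn; last exact: ltnW.
have d0 : 0 < (n - K)%:R :> R by rewrite ltr0n subn_gt0.
rewrite -[X in X <= _]mulr_natr.
rewrite mulrAC ler_pdivrMr// mulrAC (mulrC U) ler_pM2r//.
rewrite natrB; last exact: ltnW.
have nK2 : (2 / e + 1) * K%:R <= n%:R by near: n; exact: nbhs_infty_ger.
have := ler_wpM2l (ltW e20) nK2.
have -> : e / 2 * ((2 / e + 1) * K%:R) = K%:R + e / 2 * K%:R.
  by field; rewrite gt_eqF.
lra.
Unshelve. all: by end_near. Qed.

Lemma small_increments_le W N (e : R) :
  (forall k, (N <= k)%N -> `|W k.+1 - W k| <= e / k%:R) -> 0 <= e ->
  forall m n, (N <= n <= m)%N -> (0 < n)%N ->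
  `|W m - W n| <= e * (m%:R - n%:R) / n%:R.
Proof.
move=> H e0 m n /andP[Nn nm] n0.
rewrite -(subnK nm); elim: (m - n)%N => [|j ih].
  by rewrite !subrr mulr0 mul0r normr0.
rewrite addSn -(subrK (W (j + n)%N) (W _.+1)) -addrA.
apply: le_trans (ler_normD _ _) _.
have -> : e * ((j + n).+1%:R - n%:R) / n%:R =
    e / n%:R + e * ((j + n)%:R - n%:R) / n%:R.
  by rewrite -natr1; ring.
rewrite lerD//; apply: le_trans (H _ _) _; first by lia.
by rewrite ler_wpM2l// lef_pV2 ?posrE ?ltr0n ?ler_nat; lia.
Qed.

(** Between the integer parts of x and of a x there are O(x) increments, each
of size o(1 / x). *)
Lemma cvg_small_increments W (a : R) : 0 < a ->
  n%:R * (W n.+1 - W n) @[n --> \oo] --> 0 ->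
  W (Num.truncn (a * x)) - W (Num.truncn x) @[x --> +oo] --> (0 : R).
Proof.
move=> a0 Wcv; apply/cvgrPdist_le => e e0.
set b := Num.min a 1.
have b0 : 0 < b by rewrite lt_min a0 ltr01.
have [ba b1] : b <= a /\ b <= 1 by rewrite !ge_min !lexx orbT.
(* For large x the integer parts m and n of a x and x differ by at most
   (|a - 1| + 1) x, and both are at least b x / 2; C bounds |m - n| / min m n. *)
set C := (`|a - 1| + 1) / (b / 2).
have C0 : 0 < C by rewrite divr_gt0 ?divr_gt0// ltr_wpDl.
have eC : 0 < e / C by rewrite divr_gt0.
have /cvgrPdist_le /(_ _ eC) [N _ HN] := Wcv.
have H k : (N.+1 <= k)%N -> `|W k.+1 - W k| <= (e / C) / k%:R.
  move=> Nk; have := HN k (ltnW Nk); rewrite sub0r normrN normrM normr_nat.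
  move=> h; rewrite ler_pdivlMr; first by rewrite mulrC.
  by rewrite ltr0n (leq_trans _ Nk).
have eC0 := ltW eC.
near=> x.
have x1 : 1 <= x by near: x; exact: nbhs_pinfty_ge.
have xN : N.+2%:R <= x * (b / 2).
  by rewrite -ler_pdivrMr ?divr_gt0//; near: x; exact: nbhs_pinfty_ge.
have x0 : 0 <= x by lra.
have bax : b * x <= a * x by rewrite ler_wpM2r.
have b1x : b * x <= x by rewrite -[leRHS]mul1r ler_wpM2r.
have /andP[ml mu] := truncn_itv (mulr_ge0 (ltW a0) x0).
have /andP[nl nu] := truncn_itv x0.
move: ml mu nl nu; rewrite -!natr1.
set m := Num.truncn (a * x); set n := Num.truncn x => ml mu nl nu.
have key m' n' : (n' <= m')%N -> b * x - 1 <= n'%:R ->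
    m'%:R - n'%:R <= `|a - 1| * x + 1 -> `|W m' - W n'| <= e.
  move=> nm nb md.
  have nb2 : x * (b / 2) <= n'%:R.
    have : 1 <= x * (b / 2) by rewrite (le_trans _ xN)// ler1n.
    by lra.
  have Nn : (N.+1 < n')%N.
    by rewrite -(ltr_nat R) (lt_le_trans _ nb2)// (lt_le_trans _ xN)// ltr_nat.
  apply: le_trans (small_increments_le H eC0 _ _) _.
  - by rewrite (ltnW Nn).
  - exact: leq_trans Nn.
  have n0 : 0 < n'%:R :> R by rewrite ltr0n (leq_trans _ Nn).
  rewrite ler_pdivrMr// mulrAC ler_pdivrMr// -mulrA ler_wpM2l ?(ltW e0)//.
  apply: le_trans md _.
  apply: (@le_trans _ _ ((`|a - 1| + 1) * x)).
    by rewrite mulrDl lerD2l mul1r.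
  by rewrite /C mulrCA ler_wpM2l ?addr_ge0// ler_pdivlMr// divr_gt0.
have n1 := ler_norm (a - 1); have n2 := ler_norm (- (a - 1)).
rewrite normrN in n2.
have := ler_wpM2r x0 n1; have := ler_wpM2r x0 n2 => k1 k2.
rewrite sub0r normrN; have [nm|mn] := leqP n m.
  by apply: key => //; lra.
by rewrite distrC; apply: key; [exact: ltnW|lra|lra].
Unshelve. all: by end_near. Qed.

Lemma ln1D_ge (y : R) : 0 <= y -> y / (1 + y) <= ln (1 + y).
Proof.
move=> y0; have y1 : 0 < 1 + y by rewrite ltr_wpDr.
have -> : ln (1 + y) = - ln (1 + - (y / (1 + y))).
  have -> : 1 + - (y / (1 + y)) = (1 + y)^-1 by field; rewrite gt_eqF.
  by rewrite lnV ?posrE// opprK.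
rewrite lerNr; apply: le_ln1Dx.
by rewrite ltrNl opprK ltr_pdivrMr// mul1r ltrDr.
Qed.

(** Squeeze: y / (1 + y) <= ln (1 + y) <= y at y = s n / n. *)
Lemma cvg_mul_ln1D (s : nat -> R) (c : R) :
  (forall n, 0 <= s n) -> s n @[n --> \oo] --> c ->
  n%:R * ln (1 + s n / n%:R) @[n --> \oo] --> c.
Proof.
move=> s0 sc.
have sn : s n / n%:R @[n --> \oo] --> 0.
  rewrite -(mulr0 c); apply: cvgM => //.
  apply/gtr0_cvgV0; last exact: cvgr_idn.
  by near=> n; rewrite ltr0n; near: n; exists 1%N.
have lo : s n / (1 + s n / n%:R) @[n --> \oo] --> c.
  rewrite -[X in _ --> X]divr1; apply: cvgM => //; apply: cvgV => //.
  by rewrite -[X in _ --> X]addr0; apply: cvgD => //; exact: cvg_cst.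
apply: squeeze_cvgr lo sc; near=> n.
have n0 : 0 < n%:R :> R by rewrite ltr0n; near: n; exists 1%N.
have y0 : 0 <= s n / n%:R by rewrite divr_ge0.
apply/andP; split.
  apply: le_trans (ler_wpM2l (ltW n0) (ln1D_ge y0)).
  by rewrite mulrA (mulrC n%:R) divfK ?gt_eqF.
apply: le_trans (ler_wpM2l (ltW n0) (le_ln1Dx _)) _.
  by rewrite (lt_le_trans _ y0).
by rewrite mulrC divfK// gt_eqF.
Unshelve. all: by end_near. Qed.

Lemma measurable_truncn (D : set R) : measurable_fun D (fun x => Num.truncn x).
Proof.
apply: (measurable_funS measurableT) => // _ Y _; rewrite setTI.
have -> : (fun x : R => Num.truncn x) @^-1` Y =
    \bigcup_(n in Y) ([set x : R | x < n.+1%:R] `&`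
      ~` [set x : R | (0 < n)%N && (x < n%:R)]).
  apply/seteqP; split=> [x Yx|x [n Yn [/= h1 h2]]]/=.
    exists (Num.truncn x) => //; split => /=; first by rewrite -truncn_le_nat.
    by case E : (Num.truncn x) => [//|n]; rewrite /= -truncn_le_nat E ltnn.
  rewrite (_ : Num.truncn x = n)//; apply/eqP; rewrite eqn_leq truncn_le_nat h1/=.
  case: n {Yn h1} h2 => // n /=; rewrite -truncn_le_nat => /negP.
  by rewrite -ltnNge.
apply: bigcup_measurable => n _; apply: measurableI.
  by rewrite -set_itvNyo; exact: measurable_itv.
apply: measurableC; case: n => [|n] /=.
  by rewrite (_ : [set _ | _] = set0)//; apply/seteqP; split => x.
by rewrite -set_itvNyo; exact: measurable_itv.
Qed.

(** With U the partial sums of p, r n = n p n / U n tends to rho and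
n^(1 - rho) p n = r n exp (W n), where W n = ln (U n) - rho ln n has increments
ln (1 + r n / n) - rho ln (1 + 1 / n) = o(1 / n). *)
Lemma recurrence_regularly_varying p a rho : 0 < rho ->
  (forall n, 0 < p n) -> {homo p : m n / (m <= n)%N >-> n <= m} ->
  (forall n, `|a n - rho| <= 1) -> a n @[n --> \oo] --> rho ->
  (forall n, n%:R * p n = \sum_(k < n) a (n - k)%N * p k) ->
  exists l : R -> R, slowly_varying l /\
    forall n : nat, (1 <= n)%N -> p n = n%:R `^ (rho - 1) * l n%:R.
Proof.
move=> rho0 p0 pd a1 acv rec.
have rcv := cvg_ratio_partial_sum p0 pd a1 acv rec.
set U := fun n => \sum_(k < n) p k.
set r := fun n => n%:R * p n / U n.
rewrite -/U -/r in rcv.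
have U0 n : (0 < n)%N -> 0 < U n.
  case: n => // n _; rewrite /U big_ord_recl ltr_wpDr// sumr_ge0// => i _; exact: ltW.
have U_ge0 n : 0 <= U n by rewrite sumr_ge0// => i _; exact: ltW.
have r_ge0 n : 0 <= r n by rewrite divr_ge0// mulr_ge0// ltW.
pose W n := ln (U n) - rho * ln n%:R.
pose L n := n%:R `^ (1 - rho) * p n.
have LE n : (0 < n)%N -> L n = r n * expR (W n).
  move=> n0; have n0R : 0 < n%:R :> R by rewrite ltr0n.
  rewrite /L /r /W expRB lnK ?posrE ?U0// /powR gt_eqF//.
  rewrite mulrBl mul1r expRB lnK ?posrE//.
  by field; rewrite !gt_eqF ?expR_gt0 ?U0.
have Wcv : n%:R * (W n.+1 - W n) @[n --> \oo] --> 0.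
  have h1 := cvg_mul_ln1D r_ge0 rcv.
  have h2 := @cvg_mul_ln1D (fun=> 1) 1 (fun=> ler01) (cvg_cst _).
  have h3 : n%:R * ln (1 + r n / n%:R) - rho * (n%:R * ln (1 + 1 / n%:R))
      @[n --> \oo] --> 0.
    rewrite -(subrr rho) -[X in _ - X]mulr1; apply: cvgB; first exact: h1.
    by apply: cvgM; [exact: cvg_cst|exact: h2].
  apply: cvg_trans h3; apply: near_eq_cvg; near=> n; rewrite /=.
  have n0 : (0 < n)%N by near: n; exists 1%N.
  have n0R : 0 < n%:R :> R by rewrite ltr0n.
  rewrite /W.
  have -> : U n.+1 = U n * (1 + r n / n%:R).
    by rewrite /U big_ord_recr/= -/(U n) /r; field; rewrite !gt_eqF ?U0.
  have -> : n.+1%:R = n%:R * (1 + 1 / n%:R) :> R.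
    by rewrite -natr1; field; rewrite gt_eqF.
  rewrite !lnM ?posrE ?U0 ?ltr_wpDr ?divr_ge0 ?mulr_ge0 ?(ltW (p0 _))//.
  move: (ln (1 + r n / n%:R)) (ln (1 + 1 / n%:R)) (ln n%:R) (ln (U n)).
  by move=> A B C D; ring.
(* The maximum with 1 keeps the function positive on ]0, 1[. *)
exists (fun x => L (maxn 1 (Num.truncn x))); split; last first.
  move=> n n1; rewrite natrK (maxn_idPr n1) /L mulrA -powRD; last first.
    by apply/implyP; rewrite pnatr_eq0 -lt0n n1.
  by rewrite addrA subrK subrr powRr0 mul1r.
split.
- apply: (@measurableT_comp _ _ _ _ _ _ (fun n => L (maxn 1 n))) => //.
  exact: measurable_truncn.
- by move=> x _; rewrite /L mulr_gt0// powR_gt0 ltr0n leq_max.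
- move=> b b0.
  have Wb := cvg_small_increments b0 Wcv.
  have tr_cvg (c : R) : 0 < c -> Num.truncn (c * x) @[x --> +oo] --> \oo.
    move=> c0 A [N _ NA]; change (\forall x \near +oo, A (Num.truncn (c * x))).
    near=> x; apply: NA; change (N <= Num.truncn (c * x))%N.
    rewrite truncn_ge_nat; last first.
      by rewrite mulr_ge0 ?(ltW c0)//; near: x; exact: nbhs_pinfty_ge.
    by rewrite mulrC -ler_pdivrMr//; near: x; exact: nbhs_pinfty_ge.
  have tr1 : Num.truncn (x : R) @[x --> +oo] --> \oo.
    have -> : (fun x : R => Num.truncn x) = (fun x : R => Num.truncn (1 * x)).
      by apply/funext => x; rewrite mul1r.
    exact: tr_cvg.
  have h : r (Num.truncn (b * x)) / r (Num.truncn x) *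
     expR (W (Num.truncn (b * x)) - W (Num.truncn x)) @[x --> +oo] --> (1 : R).
    have -> : (1 : R) = rho / rho * expR 0.
      by rewrite expR0 mulr1 divff// gt_eqF.
    apply: cvgM; last exact: continuous_cvg (@continuous_expR _ _) Wb.
    apply: cvgM; first exact: cvg_comp (tr_cvg _ b0) rcv.
    apply: cvgV; first by rewrite gt_eqF.
    exact: cvg_comp tr1 rcv.
  apply: cvg_trans h; apply: near_eq_cvg; near=> x.
  have t1 : (0 < Num.truncn x)%N.
    by rewrite truncn_gt0; near: x; exact: nbhs_pinfty_ge.
  have t2 : (0 < Num.truncn (b * x))%N.
    by rewrite truncn_gt0 mulrC -ler_pdivrMr//; near: x; exact: nbhs_pinfty_ge.
  rewrite (maxn_idPr t1) (maxn_idPr t2) !LE// expRB.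
  by rewrite mulf_div.
Unshelve. all: by end_near. Qed.

End regular_variation.

Unset Implicit Arguments.

Theorem theorem4p5 (d : measure_display) (T : measurableType d) (R : realType)
    (P : probability T R) (X : nat -> {RV P >-> R}) (rho : R)
    (indep : mutually_independent X)
    (ident : identically_distributed X)
    (rho_gt0 : 0 < rho) (rho_lt1 : rho < 1)
    (pos_cvg : P [set w | 0 < walk X n w] @[n --> \oo] --> rho%:E) :
  exists l : R -> R, slowly_varying l /\
    forall n : nat, (1 <= n)%N ->
      P [set w | (n%:R%:E < tau0 X w)%E] = (n%:R `^ (rho - 1) * l n%:R)%:E.
Proof.
have rhoE : positive_prob X n @[n --> \oo] --> rho by exact: fine_cvg.
have a01 := positive_prob_itv X.
have p_gt0 n : 0 < stay_prob X n.
  (* By the recurrence p m is positive whenever a m is, that is for all large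
     m; monotonicity brings this down to every n. *)
  have [N _ HN] : \forall n \near \oo, 0 < positive_prob X n.
    exact: (cvgr_gt rho).
  have [m [nm am]] : exists m, (n <= m.+1)%N /\ 0 < positive_prob X m.+1.
    exists (n + N)%N; split; first by rewrite leqW// leq_addr.
    by apply: HN; rewrite /= leqW// leq_addl.
  apply: lt_le_trans (stay_prob_nonincreasing X nm).
  rewrite -(pmulr_rgt0 _ (ltr0Sn R m)) (spitzer_recurrence indep ident).
  rewrite big_ord_recl/= stay_prob0 mulr1 subn0 ltr_wpDr//.
  by apply: sumr_ge0 => k _; rewrite mulr_ge0// ?fine_ge0.
have a_rho n : `|positive_prob X n - rho| <= 1.
  by rewrite ler_norml; have := a01 n; lra.
have [l [sl hl]] := recurrence_regularly_varying rho_gt0 p_gt0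
  (stay_prob_nonincreasing X) a_rho rhoE (spitzer_recurrence indep ident).
exists l; split=> // n n1; rewrite -hl// -stay_probE; congr (P _).
by apply/seteqP; split => w /=; rewrite lt_tau0.
Qed.
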